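(* Suppose that $q\in(0,1)$, and that $a\neq 0$ and $b$ are real numbers with $b<0$ and $|b|>|a|$. Let $f\in C([0,\infty);\mathbb{R})$, let $\zeta\in\mathbb{R}$, and let $x$ be the unique continuous solution of $$x'(t)=ax(qt)+bx(t)+f(t),\quad t\ge 0;\qquad x(0)=\zeta .$$ Let $y$ be the unique continuous solution of $y'(t)=-y(t)+f(t)$, $t\ge 0$, $y(0)=0$. Then the following are equivalent: (A) $y$ is bounded; (B) there exists $F\ge 0$ such that $\left|\int_t^{t+\theta} f(s)\,ds\right|\le F$ for all $\theta\in[0,1]$ and all $t\ge 0$; (C) $x$ is bounded.
   Context: All functions are real valued and defined on $[0,\infty)$; bounded means bounded on $[0,\infty)$. Explicitly, $y(t)=\int_0^t e^{-(t-s)}f(s)\,ds$. *)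

(* Defs.v *)
From Stdlib Require Import Reals.
From Coquelicot Require Import Coquelicot.
Open Scope R_scope.

(* A function on [0,oo) is represented by a total function R -> R whose values
   at negative arguments are never constrained or used: continuity and
   derivatives are relative to this set, hence one-sided at 0. *)
Definition half_line (t : R) : Prop := 0 <= t.

Definition bounded_on_half_line (g : R -> R) : Prop :=
  exists M : R, forall t : R, 0 <= t -> Rabs (g t) <= M.

Definition solves_ivp (rhs : (R -> R) -> R -> R) (x0 : R) (x : R -> R) : Prop :=
  continuous_on half_line x /\
  (forall t : R, 0 <= t -> D_in x (rhs x) half_line t) /\
  x 0 = x0.

Definition pantograph_rhs (a b q : R) (f : R -> R) (x : R -> R) (t : R) : R :=
  a * x (q * t) + b * x t + f t.

Definition relaxation_rhs (f : R -> R) (y : R -> R) (t : R) : R :=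
  - y t + f t.

Definition bounded_moving_integrals (f : R -> R) : Prop :=
  exists F : R, 0 <= F /\
    forall theta t : R, 0 <= theta <= 1 -> 0 <= t ->
      Rabs (RInt f t (t + theta)) <= F.

(* Main.v *)
Require Import Defs.
From Stdlib Require Import Reals.
From Coquelicot Require Import Coquelicot.
From Stdlib Require Import Lra.
Open Scope R_scope.

(** The relaxation equation is the pantograph equation with [a = 0] and
    [b = -1], so both equivalences are instances of one statement: a solution
    [x] of a pantograph equation with [Rabs a < - b] is bounded if and only if
    the moving integrals of the forcing [f] are bounded.

    If [x] is bounded, then [x - P], with [P] a primitive of [f], has the
    bounded derivative [a x(qt) + b x(t)]; the mean value theorem bounds its
    increments over intervals of length at most one, hence those of [P]
    ([bounded_solution_bounds_moving_integrals]).

    Conversely, boundedness of the moving integrals makes [f] a sum [u' + h]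
    with [u] and [h] both bounded: [u] is [P] minus its average over
    [[t, t+1]], and [h] is the integral of [f] over [[t, t+1]]
    ([bounded_moving_integrals_decomposition]). Then [z = x - u] solves the
    same pantograph equation with the bounded forcing
    [a u(qt) + b u(t) + h(t)]. Such a [z] is bounded by a maximum principle
    ([bounded_forcing_bounds_solution]): where [Rabs z] is maximal on [[0, t]],
    the delayed term is dominated by the damping [b z], so a large maximum
    would force [Rabs z] to decrease strictly there. *)

(** * From the half line to the real line *)

(** Freezing a function at its value at [0] turns one-sided continuity on the
    half line into continuity on all of [R], which the integration and mean
    value theorems ask for, without changing it on the half line. *)
Definition freeze_negative (g : R -> R) (t : R) : R := g (Rmax 0 t).

Lemma freeze_negative_id g t : 0 <= t -> freeze_negative g t = g t.
Proof. intros Ht; unfold freeze_negative; now rewrite Rmax_right. Qed.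

Lemma freeze_negative_continuous g :
  continuous_on half_line g -> forall t, continuous (freeze_negative g) t.
Proof.
  intros Hg t P HP.
  assert (Hm : 0 <= Rmax 0 t) by apply Rmax_l.
  destruct (Hg _ Hm P HP) as [e He].
  exists e; intros s Hs.
  apply He; [ | apply Rmax_l].
  change (Rabs (s - t) < e) in Hs.
  change (Rabs (Rmax 0 s - Rmax 0 t) < e).
  revert Hs; unfold Rmax, Rabs.
  repeat (destruct (Rle_dec _ _) || destruct (Rcase_abs _)); lra.
Qed.

(** Away from the endpoint [0] the relative derivative is two-sided, and it is
    a local notion, so it survives freezing. *)
Lemma freeze_negative_derive g d t :
  0 < t -> D_in g d half_line t -> is_derive (freeze_negative g) t (d t).
Proof.
  intros Ht Hd.
  apply is_derive_ext_loc with g.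
  { exists (mkposreal t Ht); intros s Hs.
    change (Rabs (s - t) < t) in Hs; apply Rabs_def2 in Hs.
    symmetry; apply freeze_negative_id; lra. }
  apply is_derive_Reals; intros eps Heps.
  destruct (Hd eps Heps) as [del [Hdel H]].
  exists (mkposreal (Rmin del t) (Rmin_pos _ _ Hdel Ht)); simpl.
  intros k Hk Hkd.
  assert (Rabs k < del) by (eapply Rlt_le_trans; [exact Hkd | apply Rmin_l]).
  assert (Hkt : Rabs k < t) by (eapply Rlt_le_trans; [exact Hkd | apply Rmin_r]).
  apply Rabs_def2 in Hkt.
  specialize (H (t + k)); simpl in H; unfold Rdist in H.
  replace (t + k - t) with k in H by ring.
  apply H; repeat split; unfold half_line; lra.
Qed.

(** * A maximum principle for bounded forcing *)

Lemma derive_nonneg_at_left_max z d T :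
  0 < T -> is_derive z T d -> (forall s, 0 <= s <= T -> z s <= z T) -> 0 <= d.
Proof.
  intros HT Hd Hmax.
  apply Rnot_lt_le; intros Hneg.
  apply is_derive_Reals in Hd.
  destruct (Hd (- d)) as [del H]; [lra | ].
  pose proof (cond_pos del).
  pose proof (Rmin_l (del / 2) T); pose proof (Rmin_r (del / 2) T).
  assert (0 < Rmin (del / 2) T) by (apply Rmin_pos; lra).
  set (k := Rmin (del / 2) T) in *.
  specialize (H (- k)).
  rewrite Rabs_Ropp, (Rabs_pos_eq k) in H by lra.
  assert (Hq : Rabs ((z (T + - k) - z T) / - k - d) < - d) by (apply H; lra).
  apply Rabs_def2 in Hq.
  assert (z (T + - k) <= z T) by (apply Hmax; lra).
  assert (0 <= (z (T + - k) - z T) / - k); [ | lra].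
  replace ((z (T + - k) - z T) / - k) with ((z T - z (T + - k)) / k)
    by (field; lra).
  apply Rdiv_le_0_compat; lra.
Qed.

Lemma Rabs_le_sign_witness r :
  exists sg, (sg = 1 \/ sg = -1) /\ sg * r = Rabs r.
Proof.
  destruct (Rle_dec 0 r).
  - exists 1; rewrite Rabs_pos_eq by lra; split; [tauto | ring].
  - exists (-1); rewrite Rabs_left by lra; split; [tauto | ring].
Qed.

(** Maximum principle. At a maximum point [T > 0] of [Rabs z] on [[0, t]] the
    derivative of [Rabs z] is at most [(Rabs a + b) * Rabs (z T) + H], because
    [q * T] lies in [[0, t]] too; but it is nonnegative, as [T] is a maximum
    from the left. This caps the maximum by [H / (- b - Rabs a)], unless
    [T = 0], where it is [Rabs (z 0)]. *)
Lemma bounded_forcing_bounds_solution q a b H (z h : R -> R) :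
  0 < q < 1 -> Rabs a < - b ->
  (forall t, continuous z t) ->
  (forall t, 0 < t -> is_derive z t (a * z (q * t) + b * z t + h t)) ->
  (forall t, 0 <= t -> Rabs (h t) <= H) ->
  bounded_on_half_line z.
Proof.
  intros Hq Hab Hc Hd Hh.
  exists (Rmax (Rabs (z 0)) (H / (- b - Rabs a))); intros t Ht.
  destruct (continuity_ab_maj (fun s => Rabs (z s)) 0 t Ht) as [T [Hmax HT]].
  { intros s _; apply continuity_pt_filterlim.
    apply (continuous_comp z Rabs); [apply Hc | apply continuous_Rabs]. }
  apply Rle_trans with (Rabs (z T)); [apply Hmax; lra | ].
  destruct (Req_dec T 0) as [-> | HT0]; [apply Rmax_l | ].
  apply Rle_trans with (2 := Rmax_r _ _).
  apply Rle_div_r; [lra | ].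
  destruct (Rabs_le_sign_witness (z T)) as [sg [Hsg HsgT]].
  assert (Hle : forall r, sg * r <= Rabs r).
  { intros r; pose proof (Rle_abs r); pose proof (Rle_abs (- r)) as Hn.
    rewrite Rabs_Ropp in Hn; destruct Hsg as [-> | ->]; lra. }
  assert (H0 : 0 <= sg * (a * z (q * T) + b * z T + h T)).
  { apply (derive_nonneg_at_left_max (fun s => sg * z s) _ T); [lra | | ].
    - apply (is_derive_scal z T sg), Hd; lra.
    - intros s Hs; rewrite HsgT.
      apply Rle_trans with (1 := Hle _), Hmax; lra. }
  assert (HqT : 0 <= q * T <= t) by nra.
  pose proof (Hmax _ HqT) as Hdelay; simpl in Hdelay.
  pose proof (Hle (a * z (q * T))) as Ha; rewrite Rabs_mult in Ha.
  pose proof (Rmult_le_compat_l _ _ _ (Rabs_pos a) Hdelay).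
  assert (HT' : 0 <= T) by lra.
  pose proof (Rle_trans _ _ _ (Hle (h T)) (Hh T HT')).
  replace (sg * (a * z (q * T) + b * z T + h T))
    with (sg * (a * z (q * T)) + b * (sg * z T) + sg * h T) in H0 by ring.
  rewrite HsgT in H0; lra.
Qed.

(** * Forcings with bounded moving integrals *)

Lemma ex_RInt_of_continuous (f : R -> R) :
  (forall t, continuous f t) -> forall s t, ex_RInt f s t.
Proof. intros Hf s t; apply (ex_RInt_continuous (V := R_CompleteNormedModule)); intros; apply Hf. Qed.

Lemma RInt_from_0_derive (f : R -> R) :
  (forall t, continuous f t) -> forall t, is_derive (RInt f 0) t (f t).
Proof.
  intros Hf t; apply (is_derive_RInt f (RInt f 0) 0); [ | apply Hf].
  apply filter_forall; intros s.
  apply (RInt_correct f), ex_RInt_of_continuous, Hf.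
Qed.

Lemma RInt_eq_primitive_increment (f : R -> R) :
  (forall t, continuous f t) ->
  forall s t, RInt f s t = RInt f 0 t - RInt f 0 s.
Proof.
  intros Hf s t.
  pose proof (RInt_Chasles f 0 s t (ex_RInt_of_continuous f Hf 0 s)
    (ex_RInt_of_continuous f Hf s t)) as E.
  change (RInt f 0 s + RInt f s t = RInt f 0 t) in E; lra.
Qed.

(** With [P] a primitive of [f], take [u] to be [P] minus its average over
    [[t, t+1]]. That average is a value of [P] at some [c] in [[t, t+1]], so
    [u t] is minus a moving integral of [f]; and differentiating the average
    gives the increment of [P] over [[t, t+1]], also a moving integral. *)
Lemma bounded_moving_integrals_decomposition (f : R -> R) :
  (forall t, continuous f t) -> bounded_moving_integrals f ->
  exists u h : R -> R,
    (forall t, is_derive u t (f t - h t)) /\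
    bounded_on_half_line u /\ bounded_on_half_line h.
Proof.
  intros Hf [F [HF HB]].
  set (P := RInt f 0).
  assert (dP : forall t, is_derive P t (f t)) by (apply RInt_from_0_derive, Hf).
  assert (cP : forall t, continuous P t)
    by (intros t; apply (ex_derive_continuous P); exists (f t); apply dP).
  assert (dI := RInt_from_0_derive P cP).
  set (I := RInt P 0) in *.
  assert (HBP : forall t s, 0 <= t -> t <= s <= t + 1 -> Rabs (P s - P t) <= F).
  { intros t s Ht Hs; unfold P; rewrite <- RInt_eq_primitive_increment by apply Hf.
    replace s with (t + (s - t)) by ring; apply HB; lra. }
  exists (fun t => P t - (I (t + 1) - I t)), (fun t => P (t + 1) - P t).
  split; [ | split].
  - intros t.
    apply (is_derive_minus P (fun s => I (s + 1) - I s)); [apply dP | ].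
    apply (is_derive_minus (fun s => I (s + 1)) I); [ | apply dI].
    replace (P (t + 1)) with (1 * P (t + 1)) by ring.
    apply (is_derive_comp I (fun s => s + 1)); [apply dI | ].
    auto_derive; [exact Logic.I | ring].
  - exists F; intros t Ht.
    destruct (MVT_gen I t (t + 1) P) as [c [Hc E]].
    + intros s _; apply dI.
    + intros s _; apply continuity_pt_filterlim, (ex_derive_continuous I).
      exists (P s); apply dI.
    + rewrite Rmin_left, Rmax_right in Hc by lra.
      replace (P t - (I (t + 1) - I t)) with (- (P c - P t)) by (rewrite E; ring).
      rewrite Rabs_Ropp; apply HBP; lra.
  - exists F; intros t Ht; apply HBP; lra.
Qed.

(** * Boundedness of solutions versus boundedness of moving integrals *)

(** Subtracting the bounded part [u] of the decomposition [f = u' + h] removes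
    the possibly unbounded [u'] from the forcing, at the price of the bounded
    terms [a u(qt) + b u(t)]. *)
Lemma bounded_moving_integrals_bound_solution q a b (f x : R -> R) :
  0 < q < 1 -> Rabs a < - b ->
  (forall t, continuous f t) -> (forall t, continuous x t) ->
  (forall t, 0 < t -> is_derive x t (pantograph_rhs a b q f x t)) ->
  bounded_moving_integrals f -> bounded_on_half_line x.
Proof.
  intros Hq Hab Hf Hc Hd HB.
  destruct (bounded_moving_integrals_decomposition f Hf HB)
    as (u & h & du & [U HU] & [H HH]).
  assert (Hz : bounded_on_half_line (fun t => x t - u t)).
  { apply (bounded_forcing_bounds_solution q a b (Rabs a * U + Rabs b * U + H) _
      (fun t => a * u (q * t) + b * u t + h t)); try assumption.
    - intros t; apply (continuous_minus x u); [apply Hc | ].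
      apply (ex_derive_continuous u); eexists; apply du.
    - intros t Ht.
      replace (a * (x (q * t) - u (q * t)) + b * (x t - u t)
               + (a * u (q * t) + b * u t + h t))
        with (pantograph_rhs a b q f x t - (f t - h t))
        by (unfold pantograph_rhs; ring).
      apply (is_derive_minus x u); [apply Hd, Ht | apply du].
    - intros t Ht.
      assert (Hqt : 0 <= q * t) by nra.
      pose proof (Rmult_le_compat_l _ _ _ (Rabs_pos a) (HU _ Hqt)).
      pose proof (Rmult_le_compat_l _ _ _ (Rabs_pos b) (HU _ Ht)).
      pose proof (HH _ Ht).
      pose proof (Rabs_triang (a * u (q * t) + b * u t) (h t)).
      pose proof (Rabs_triang (a * u (q * t)) (b * u t)).
      rewrite !Rabs_mult in *; lra. }
  destruct Hz as [Z HZ].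
  exists (Z + U); intros t Ht.
  replace (x t) with ((x t - u t) + u t) by ring.
  apply Rle_trans with (1 := Rabs_triang _ _).
  pose proof (HZ t Ht); pose proof (HU t Ht); simpl in *; lra.
Qed.

(** The moving integral of [f] is an increment of [x] minus an increment of
    [x - P], [P] being a primitive of [f]; the latter has the derivative
    [a x(qt) + b x(t)], which is bounded along with [x]. *)
Lemma bounded_solution_bounds_moving_integrals q a b (f x : R -> R) :
  0 < q < 1 ->
  (forall t, continuous f t) -> (forall t, continuous x t) ->
  (forall t, 0 < t -> is_derive x t (pantograph_rhs a b q f x t)) ->
  bounded_on_half_line x -> bounded_moving_integrals f.
Proof.
  intros Hq Hf Hc Hd [M HM].
  pose proof (Rabs_pos a); pose proof (Rabs_pos b).
  assert (HM0 : 0 <= M)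
    by (apply Rle_trans with (1 := Rabs_pos (x 0)), HM; lra).
  set (G := Rabs a * M + Rabs b * M).
  assert (HG : 0 <= G) by (unfold G; nra).
  exists (M + M + G); split; [lra | ].
  intros th t Hth Ht.
  pose proof (RInt_from_0_derive f Hf) as dP.
  destruct (MVT_gen (fun s => x s - RInt f 0 s) t (t + th)
    (fun s => a * x (q * s) + b * x s)) as [c [Hcc E]].
  - intros s Hs; rewrite Rmin_left in Hs by lra.
    replace (a * x (q * s) + b * x s)
      with (pantograph_rhs a b q f x s - f s) by (unfold pantograph_rhs; ring).
    apply (is_derive_minus x (RInt f 0)); [apply Hd; lra | apply dP].
  - intros s _; apply continuity_pt_filterlim.
    apply (continuous_minus x (RInt f 0)); [apply Hc | ].
    apply (ex_derive_continuous (RInt f 0)); exists (f s); apply dP.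
  - rewrite Rmin_left, Rmax_right in Hcc by lra.
    rewrite RInt_eq_primitive_increment by apply Hf.
    replace (RInt f 0 (t + th) - RInt f 0 t)
      with (x (t + th) + - x t + - ((a * x (q * c) + b * x c) * th)) by lra.
    assert (Hc0 : 0 <= c) by lra.
    assert (Hqc : 0 <= q * c) by nra.
    assert (Hg : Rabs (a * x (q * c) + b * x c) <= G).
    { apply Rle_trans with (1 := Rabs_triang _ _); rewrite !Rabs_mult; unfold G.
      pose proof (Rmult_le_compat_l _ _ _ (Rabs_pos a) (HM _ Hqc)).
      pose proof (Rmult_le_compat_l _ _ _ (Rabs_pos b) (HM _ Hc0)); lra. }
    pose proof (Rabs_pos (a * x (q * c) + b * x c)).
    assert (Hgth : Rabs ((a * x (q * c) + b * x c) * th) <= G)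
      by (rewrite Rabs_mult, (Rabs_pos_eq th) by lra; nra).
    assert (Hs0 : 0 <= t + th) by lra.
    pose proof (HM _ Hs0); pose proof (HM _ Ht).
    apply Rle_trans with (1 := Rabs_triang _ _); rewrite Rabs_Ropp.
    pose proof (Rabs_triang (x (t + th)) (- x t)) as Htr.
    rewrite Rabs_Ropp in Htr; lra.
Qed.

(** * The equivalence on the half line *)

Lemma freeze_negative_bounded g :
  bounded_on_half_line (freeze_negative g) <-> bounded_on_half_line g.
Proof.
  split; intros [M HM]; exists M; intros t Ht;
    specialize (HM t Ht); now rewrite freeze_negative_id in *.
Qed.

Lemma freeze_negative_moving_integrals f :
  bounded_moving_integrals (freeze_negative f) <-> bounded_moving_integrals f.
Proof.
  assert (E : forall th t, 0 <= th -> 0 <= t ->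
    RInt (freeze_negative f) t (t + th) = RInt f t (t + th)).
  { intros th t Hth Ht; apply RInt_ext; intros s Hs.
    rewrite Rmin_left in Hs by lra; apply freeze_negative_id; lra. }
  split; intros [F [HF HB]]; exists F; (split; [exact HF | ]);
    intros th t Hth Ht; specialize (HB th t Hth Ht);
    rewrite E in * by lra; exact HB.
Qed.

Lemma pantograph_bounded_iff q a b zeta (f x : R -> R) :
  0 < q < 1 -> Rabs a < - b ->
  continuous_on half_line f -> solves_ivp (pantograph_rhs a b q f) zeta x ->
  bounded_moving_integrals f <-> bounded_on_half_line x.
Proof.
  intros Hq Hab Hf [Hc [Hd _]].
  rewrite <- freeze_negative_moving_integrals, <- freeze_negative_bounded.
  pose proof (freeze_negative_continuous f Hf).
  pose proof (freeze_negative_continuous x Hc).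
  assert (forall t, 0 < t -> is_derive (freeze_negative x) t
    (pantograph_rhs a b q (freeze_negative f) (freeze_negative x) t)).
  { intros t Ht.
    assert (0 <= q * t) by nra.
    unfold pantograph_rhs; rewrite !freeze_negative_id by lra.
    apply (freeze_negative_derive x (pantograph_rhs a b q f x)); [exact Ht | ].
    apply Hd; lra. }
  split.
  - now apply (bounded_moving_integrals_bound_solution q a b).
  - now apply (bounded_solution_bounds_moving_integrals q a b).
Qed.

Lemma relaxation_is_pantograph q y0 (f y : R -> R) :
  solves_ivp (relaxation_rhs f) y0 y ->
  solves_ivp (pantograph_rhs 0 (-1) q f) y0 y.
Proof.
  intros [Hc [Hd H0]]; repeat split; try assumption.
  intros t Ht.
  specialize (Hd t Ht); unfold D_in in *.
  replace (pantograph_rhs 0 (-1) q f y t) with (relaxation_rhs f y t)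
    by (unfold pantograph_rhs, relaxation_rhs; ring).
  exact Hd.
Qed.

Theorem theorem7 (q a b zeta : R) (f x y : R -> R)
  (hq : 0 < q < 1) (ha : a <> 0) (hb : b < 0) (hab : Rabs a < Rabs b)
  (hf : continuous_on half_line f)
  (hx : solves_ivp (pantograph_rhs a b q f) zeta x)
  (hy : solves_ivp (relaxation_rhs f) 0 y) :
  (bounded_on_half_line y <-> bounded_moving_integrals f) /\
  (bounded_moving_integrals f <-> bounded_on_half_line x).
Proof.
  split.
  - symmetry; apply (pantograph_bounded_iff q 0 (-1) 0); try assumption.
    + rewrite Rabs_R0; lra.
    + now apply relaxation_is_pantograph.
  - apply (pantograph_bounded_iff q a b zeta); try assumption.
    now rewrite (Rabs_left b) in hab by assumption.
Qed.
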